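(* Let $k$ be an algebraically closed field of characteristic zero and $A=k\langle x,y\rangle/(x^3-1,y^2-1)$. Let $\alpha=(\alpha_1,\alpha_2,\alpha_3;\alpha_1',\alpha_2')$ be a Schur root, put $n=\alpha_1+\alpha_2+\alpha_3=\alpha_1'+\alpha_2'$ and $$d=1+n^2-\sum_{i=1}^3\alpha_i^2-\sum_{j=1}^2(\alpha_j')^2.$$ Then the set of weak equivalence classes of maximally iterated extensions of dimension vector $\alpha$ is finite of cardinality $N=\frac12(d+n+1)$.
   Context: $A$ is the group algebra of $PSL(2,\mathbf{Z})\simeq\mathbf{Z}_3*\mathbf{Z}_2$. The dimension vector of a finite-dimensional $A$-module $M$ is $\alpha=(\alpha_1,\alpha_2,\alpha_3;\alpha_1',\alpha_2')$, where $\alpha_1,\alpha_2,\alpha_3$ are the dimensions of the eigenspaces of $x$ for the cube roots of unity $1,\omega,\omega^2$ and $\alpha_1',\alpha_2'$ are the dimensions of the eigenspaces of $y$ for $1,-1$. A dimension vector $\alpha$ is a Schur root if there exists an $A$-module $M$ of dimension vector $\alpha$ with $End_A(M)\simeq k$. Two finite-dimensional modules are weakly equivalent if they have the same composition factors with multiplicities up to isomorphism, i.e. if their associated semi-simple modules (direct sums of the composition factors) are isomorphic. A finite-dimensional $A$-module $M$ is a maximally iterated extension if in a composition series $M=M_r\supset M_{r-1}\supset\cdots\supset M_0=0$ all factors $M_i/M_{i-1}$ have dimension $1$. *)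

(* Defs.v *)
From mathcomp Require Export all_boot all_order all_algebra.

Set Implicit Arguments.
Unset Strict Implicit.
Unset Printing Implicit Defensive.

Import GRing.Theory.
Local Open Scope ring_scope.

(* A finite-dimensional module over k<x,y>/(x^3-1,y^2-1): by the universal
   property of this algebra, a finite-dimensional space with two endomorphisms
   satisfying the two relations. The zero module is included. *)
Record amodule (k : fieldType) := AModule {
  carrier :> vectType k;
  actx : 'End(carrier);
  acty : 'End(carrier);
  actx_cube : (actx \o actx \o actx)%VF = \1%VF;
  acty_square : (acty \o acty)%VF = \1%VF
}.

Section Modules.
Variable k : fieldType.
Implicit Types M Q : amodule k.

Definition is_hom M Q (f : 'Hom(carrier M, carrier Q)) : Prop :=
  (f \o actx M = actx Q \o f)%VF /\ (f \o acty M = acty Q \o f)%VF.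

Definition module_iso M Q : Prop :=
  exists f : 'Hom(carrier M, carrier Q), is_hom f /\ bijective f.

(* End_A(M) is isomorphic to k as a k-algebra: phi is an injective morphism of
   unital k-algebras whose image is End_A(M). *)
Definition endo_ring_trivial M : Prop :=
  exists phi : {linear k^o -> 'End(carrier M)},
    [/\ phi 1 = \1%VF,
        forall a b : k, phi (a * b) = (phi a \o phi b)%VF,
        injective phi
      & forall f : 'End(carrier M), is_hom f <-> exists a : k, f = phi a].

Definition submodule M (U : {vspace carrier M}) : Prop :=
  (actx M @: U <= U)%VS /\ (acty M @: U <= U)%VS.

Definition simple_module M : Prop :=
  {:carrier M}%VS <> 0%VS /\
  forall U : {vspace carrier M},
    submodule U -> U = 0%VS \/ U = {:carrier M}%VS.

(* Q is (isomorphic to) W / U, for submodules U <= W of M: there is a short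
   exact sequence 0 -> U -> W -> Q -> 0 of modules. The map W -> Q is given by
   a linear map f on all of M, of which only the restriction to W matters. *)
Definition is_quotient M (W U : {vspace carrier M}) Q : Prop :=
  exists f : 'Hom(carrier M, carrier Q),
    [/\ {in W, forall v, f (actx M v) = actx Q (f v)},
        {in W, forall v, f (acty M v) = acty Q (f v)},
        (f @: W)%VS = {:carrier Q}%VS
      & (W :&: lker f)%VS = U].

(* 0 = F 0 <= F 1 <= ... <= F r = M is a composition series of M with factors
   F i.+1 / F i isomorphic to S i; the values F i for i > r are irrelevant. *)
Definition composition_series M (r : nat) (F : nat -> {vspace carrier M})
    (S : 'I_r -> amodule k) : Prop :=
  [/\ F 0%N = 0%VS,
      F r = {:carrier M}%VS,
      forall i : nat, (i <= r)%N -> submodule (F i)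
    & forall i : 'I_r, [/\ (F i <= F i.+1)%VS,
                           is_quotient (F i.+1) (F i) (S i)
                         & simple_module (S i)]].

Definition composition_factors M (r : nat) (S : 'I_r -> amodule k) : Prop :=
  exists F : nat -> {vspace carrier M}, composition_series F S.

Definition weakly_equivalent M Q : Prop :=
  exists (r : nat) (S T : 'I_r -> amodule k),
    [/\ composition_factors M S,
        composition_factors Q T
      & exists2 s : 'I_r -> 'I_r, bijective s &
          forall i : 'I_r, module_iso (S i) (T (s i))].

Definition maximally_iterated_extension M : Prop :=
  exists (r : nat) (S : 'I_r -> amodule k),
    composition_factors M S /\
    forall i : 'I_r, \dim {:carrier (S i)}%VS = 1%N.

(* Indices are shifted: a i is the dimension for the eigenvalue omega ^+ i of
   x, and b j the dimension for the eigenvalue (-1) ^+ j of y. *)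
Definition has_dimension_vector (omega : k) M
    (a : 'I_3 -> nat) (b : 'I_2 -> nat) : Prop :=
  (forall i : 'I_3, \dim (passmx.leigenspace (actx M) (omega ^+ i)) = a i) /\
  (forall j : 'I_2, \dim (passmx.leigenspace (acty M) ((-1) ^+ j)) = b j).

Definition schur_root (omega : k) (a : 'I_3 -> nat) (b : 'I_2 -> nat) : Prop :=
  exists M, has_dimension_vector omega M a b /\ endo_ring_trivial M.

Definition weak_class M : amodule k -> Prop := weakly_equivalent M.

(* The set of weak equivalence classes of maximally iterated extensions of
   dimension vector (a; b); a class is the set of all modules it contains. *)
Definition mie_weak_classes (omega : k) (a : 'I_3 -> nat) (b : 'I_2 -> nat) :
    (amodule k -> Prop) -> Prop :=
  fun C => exists M, [/\ maximally_iterated_extension M,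
                         has_dimension_vector omega M a b
                       & C = weak_class M].

End Modules.

(* The subset P of T is finite with N elements. The cardinals of
   mathcomp.classical cannot be used here: its type set T lives in a universe
   strictly below that of vectType, hence cannot be applied to amodule k.
   Sets are therefore plain predicates, equal when they have the same elements
   by functional and propositional extensionality. *)
Definition has_cardinal (T : Type) (P : T -> Prop) (N : nat) : Prop :=
  exists f : 'I_N -> T, injective f /\ forall t : T, P t <-> exists i, t = f i.

(* Main.v *)
Require Import Defs.
From HB Require Import structures.
From mathcomp Require Import all_boot all_order all_algebra.
From mathcomp Require Import perm zify lra.
From Stdlib Require Import FunctionalExtensionality PropExtensionality.

Set Implicit Arguments.
Unset Strict Implicit.
Unset Printing Implicit Defensive.

Import GRing.Theory Num.Theory.
Local Open Scope ring_scope.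

(** A one-dimensional module is given by a pair (i, j): x acts on it by
    omega ^+ i and y by (-1) ^+ j. By the Jordan-Hölder theorem
    ([jordan_holder]), weak equivalence is transitive and the weak class of a
    maximally iterated extension M is determined by the multiplicities m (i, j)
    of the six one-dimensional modules among its composition factors. Taking
    eigenspaces of x, or of y, is exact because these have finite order, so the
    dimension vector of M consists of the margins of the 3 x 2 matrix m
    ([dimension_vector_factors]). Conversely each matrix of natural numbers
    occurs, for a direct sum of one-dimensional modules ([split_module]). The
    weak classes of dimension vector (a; b) thus correspond to the matrices of
    natural numbers with row sums a and column sums b, that is, to the triples
    (c_0, c_1, c_2) with c_i <= a i and sum b 0: the first columns.

    The Schur condition enters only through the inequalities a i <= b j + 1
    ([schur_root_bound]). Suppose that b j + 2 <= a i, and let e be the sign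
    other than the j-th. The eigenspaces of x for omega ^+ i and of y for e have
    dimensions adding up to more than dim M, so that they share a nonzero vector,
    and the sum of the images of x - omega ^+ i and y - e is a proper subspace.
    So the one-dimensional module L with these eigenvalues embeds in M and is a
    quotient of M, and the composite of M ->> L >-> M is an endomorphism of rank
    one. It is a scalar only if dim M = 1, which is incompatible with 2 <= a i.

    Finally these inequalities say that in the inclusion-exclusion count of the
    triples no two of the bounds c_i <= a i can be violated together
    ([card_bounded_triples]), and that every remaining binomial coefficient
    agrees with its polynomial expression, even for a i = b 0 + 1, where it
    vanishes. The count is therefore the quadratic polynomial
    (b_0 + 1) (b_0 + 2) / 2 - \sum_i (b_0 - a_i) (b_0 - a_i + 1) / 2, which
    equals (d + n + 1) / 2 since n = b_0 + b_1. *)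

(** * Eigenspaces of an endomorphism of finite order *)

Lemma memv_leigenspace (k : fieldType) (V : vectType k) (g : 'End(V)) c v :
  (v \in passmx.leigenspace g c) = (g v == c *: v).
Proof.
by rewrite memv_ker !lfun_simp subr_eq0.
Qed.

Section FiniteOrder.
Variables (k : fieldType) (N : nat) (zeta : k).
Hypothesis prim_zeta : N.-primitive_root zeta.

Let N_neq0 : N%:R != 0 :> k := prim_root_natf_neq0 prim_zeta.

Let N_gt0 : (0 < N)%N := prim_order_gt0 prim_zeta.

Let zeta_neq0 : zeta != 0.
Proof. by rewrite (prim_root_eq0 prim_zeta) -lt0n. Qed.

Lemma prim_expr_inj (i j : 'I_N) : zeta ^+ i = zeta ^+ j -> i = j.
Proof.
move/eqP; rewrite (eq_prim_root_expr prim_zeta) !modn_small ?ltn_ord //.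
by move/eqP/val_inj.
Qed.

Lemma sum_expr_unity (c : k) :
  c ^+ N = 1 -> \sum_(s < N) c ^+ s = if c == 1 then N%:R else 0.
Proof.
move=> cN; case: eqP => [->|/eqP c1].
  by rewrite (eq_bigr _ (fun _ _ => expr1n _ _)) sumr_const card_ord.
have := subrX1 c N; rewrite cN subrr => /esym/eqP.
by rewrite mulf_eq0 subr_eq0 (negPf c1) => /eqP.
Qed.

Lemma iter_comp_lfunE (V : vectType k) (g : 'End(V)) s v :
  iter s (fun h => g \o h)%VF \1%VF v = iter s g v.
Proof. by elim: s => [|s IHs]; rewrite /= lfunE //= IHs. Qed.

(** The spectral projector of g on the eigenvalue zeta ^+ i, when g has order
    dividing N. *)
Definition eigenproj (V : vectType k) (g : 'End(V)) (i : nat) : 'End(V) :=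
  N%:R^-1 *: \sum_(s < N) zeta^-1 ^+ (i * s) *:
    iter s (fun h => g \o h)%VF \1%VF.

Lemma eigenprojE (V : vectType k) (g : 'End(V)) i v :
  eigenproj g i v =
  N%:R^-1 *: \sum_(s < N) zeta^-1 ^+ (i * s) *: iter s g v.
Proof.
rewrite /eigenproj lfunE /= sum_lfunE; congr (_ *: _); apply: eq_bigr => s _.
by rewrite lfunE /= iter_comp_lfunE.
Qed.

Lemma eigenproj_stable (V : vectType k) (g : 'End(V)) (W : {vspace V}) i v :
  (g @: W <= W)%VS -> v \in W -> eigenproj g i v \in W.
Proof.
move=> gW vW; rewrite eigenprojE memvZ // memv_suml // => s _; rewrite memvZ //.
by elim: (s : nat) => //= t IHt; apply: (subvP gW); apply: memv_img.
Qed.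

(** The map f is only assumed to commute with the actions on W, as for the
    quotient map of a subquotient W / U, which is given on the whole space. *)
Lemma eigenproj_intertwine (V Q : vectType k) (g : 'End(V)) (h : 'End(Q))
    (f : 'Hom(V, Q)) (W : {vspace V}) i :
    (g @: W <= W)%VS -> {in W, forall v, f (g v) = h (f v)} ->
  {in W, forall v, f (eigenproj g i v) = eigenproj h i (f v)}.
Proof.
move=> gW fgh v vW; rewrite !eigenprojE linearZ linear_sum; congr (_ *: _).
apply: eq_bigr => s _; rewrite linearZ; congr (_ *: _).
suff: iter s g v \in W /\ f (iter s g v) = iter s h (f v) by case.
elim: (s : nat) => [|t [IHW IHf]] //=; split; last by rewrite fgh ?IHf.
by apply: (subvP gW); apply: memv_img.
Qed.

Lemma eigenproj_eigen (V : vectType k) (g : 'End(V)) (i j : 'I_N) v :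
  v \in passmx.leigenspace g (zeta ^+ j) ->
  eigenproj g i v = if i == j then v else 0.
Proof.
rewrite memv_leigenspace => /eqP gv; rewrite eigenprojE.
under eq_bigr => s _.
  have -> : iter s g v = zeta ^+ (j * s) *: v.
    elim: (s : nat) => [|t IHt]; first by rewrite muln0 scale1r.
    by rewrite /= IHt linearZ /= gv scalerA -exprD mulnS addnC.
  rewrite scalerA !exprM -exprMn; over.
rewrite -scaler_suml sum_expr_unity; last first.
  by rewrite exprMn -!exprM ![(_ * N)%N]mulnC !exprM exprVn
             (prim_expr_order prim_zeta) invr1 !expr1n mulr1.
have -> : (zeta^-1 ^+ i * zeta ^+ j == 1) = (i == j).
  rewrite exprVn mulrC -subr_eq0 -(inj_eq (mulIf (expf_neq0 i zeta_neq0))).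
  rewrite mulrBl mulfVK ?expf_neq0 // mul1r mul0r subr_eq0 eq_sym.
  by apply/eqP/eqP => [/prim_expr_inj|->].
by case: eqP; rewrite scalerA ?mulVf // ?scale1r // mulr0 scale0r.
Qed.

Section Order.
Variables (V : vectType k) (g : 'End(V)).
Hypothesis gN : forall v, iter N g v = v.

Lemma eigenproj_mem i v : eigenproj g i v \in passmx.leigenspace g (zeta ^+ i).
Proof.
rewrite memv_leigenspace eigenprojE linearZ linear_sum scalerA mulrC -scalerA.
apply/eqP; congr (_ *: _).
rewrite scaler_sumr.
pose u s := zeta^-1 ^+ (i * s) *: iter s g v.
transitivity (zeta ^+ i *: \sum_(s < N) u s.+1).
  rewrite scaler_sumr; apply: eq_bigr => s _.
  rewrite linearZ /u scalerA mulnS exprD mulrA.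
  by rewrite -exprMn mulfV // expr1n mul1r.
rewrite -scaler_sumr; congr (_ *: _).
(* The summand is N-periodic, so the two sums over a full period agree. *)
have uN : u N = u 0%N.
  by rewrite /u gN mulnC exprM exprVn (prim_expr_order prim_zeta) invr1
             expr1n muln0 expr0.
have : \sum_(s < N.+1) u s = u 0%N + \sum_(s < N) u s.+1 by rewrite big_ord_recl.
by rewrite big_ord_recr /= uN addrC => /addrI.
Qed.

Lemma sum_eigenproj v : \sum_(i < N) eigenproj g i v = v.
Proof.
under eq_bigr do rewrite eigenprojE.
rewrite -scaler_sumr exchange_big /=.
under eq_bigr => s _.
  under eq_bigr => i _ do rewrite mulnC exprM.
  rewrite -scaler_suml sum_expr_unity; last first.
    by rewrite -exprM mulnC exprM exprVn (prim_expr_order prim_zeta) invr1 expr1n.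
  over.
rewrite (bigD1 (Ordinal N_gt0)) //= expr0 eqxx big1 ?addr0 => [|s s0].
  by rewrite scalerA mulVf ?scale1r.
case: eqP => [/eqP|]; last by rewrite scale0r.
rewrite exprVn invr_eq1 -(expr0 zeta) => /eqP.
by move/(@prim_expr_inj s (Ordinal N_gt0))/eqP; rewrite (negPf s0).
Qed.

Lemma sum_dim_leigenspace :
  (\sum_(i < N) \dim (passmx.leigenspace g (zeta ^+ i)) = \dim {:V})%N.
Proof.
have dir : directv (\sum_(i < N) passmx.leigenspace g (zeta ^+ i)).
  apply/directv_sum_independent => us usE us0 i _.
  have /(congr1 (eigenproj g i)) := us0.
  rewrite linear0 linear_sum (bigD1 i) //= big1 => [|j ji].
    by rewrite addr0 (eigenproj_eigen _ (usE i _)) // eqxx.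
  by rewrite (eigenproj_eigen _ (usE j _)) // eq_sym (negPf ji).
have := directvP dir => /= <-; congr (\dim _); apply/eqP.
rewrite eqEsubv subvf; apply/subvP => v _; rewrite -[v]sum_eigenproj.
by apply: memv_sumr => i _; apply: eigenproj_mem.
Qed.

(** A lift of an eigenvector of the quotient can be corrected by the spectral
    projector, which commutes with the quotient map; so taking eigenspaces is
    exact. *)
Lemma dim_leigenspace_quotient (Q : vectType k) (h : 'End(Q)) (f : 'Hom(V, Q))
    (W U : {vspace V}) (i : 'I_N) :
    (g @: W <= W)%VS -> {in W, forall v, f (g v) = h (f v)} ->
    (f @: W)%VS = {:Q}%VS -> (W :&: lker f)%VS = U ->
  (\dim (W :&: passmx.leigenspace g (zeta ^+ i))
   = \dim (U :&: passmx.leigenspace g (zeta ^+ i))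
     + \dim (passmx.leigenspace h (zeta ^+ i)))%N.
Proof.
move=> gW fgh fW <-; set E := passmx.leigenspace g _.
rewrite -(limg_ker_dim f) -!capvA [(E :&: _)%VS]capvC.
congr (_ + \dim _)%N; apply/eqP; rewrite eqEsubv; apply/andP; split.
  apply/subvP => _ /memv_imgP[v /memv_capP[vW vE] ->].
  move: vE; rewrite !memv_leigenspace -fgh // => /eqP->.
  by rewrite linearZ.
apply/subvP => q qE; have : q \in (f @: W)%VS by rewrite fW memvf.
case/memv_imgP=> w wW qw; apply/memv_imgP; exists (eigenproj g i w).
  by rewrite memv_cap eigenproj_stable ?eigenproj_mem.
by rewrite (eigenproj_intertwine _ gW fgh) // -qw (eigenproj_eigen _ qE) eqxx.
Qed.

End Order.
End FiniteOrder.

(** * The Jordan-Hölder theorem *)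

Section JordanHolder.
Variable k : fieldType.
Implicit Types M Q : amodule k.

Lemma is_homE M Q (f : 'Hom(carrier M, carrier Q)) :
  is_hom f <-> (forall v, f (actx M v) = actx Q (f v)) /\
               (forall v, f (acty M v) = acty Q (f v)).
Proof.
split=> [[fx fy]|[fx fy]]; split.
- by move=> v; rewrite -!comp_lfunE fx.
- by move=> v; rewrite -!comp_lfunE fy.
- by apply/lfunP => v; rewrite !comp_lfunE.
- by apply/lfunP => v; rewrite !comp_lfunE.
Qed.

Lemma submoduleP M (U : {vspace carrier M}) :
  submodule U <-> {in U, forall v, actx M v \in U} /\
                  {in U, forall v, acty M v \in U}.
Proof.
split=> [[Ux Uy]|[Ux Uy]]; split.
- by move=> v vU; apply: (subvP Ux); apply: memv_img.
- by move=> v vU; apply: (subvP Uy); apply: memv_img.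
- by apply/subvP => _ /memv_imgP[v vU ->]; apply: Ux.
- by apply/subvP => _ /memv_imgP[v vU ->]; apply: Uy.
Qed.

Lemma module_iso_sym M Q : module_iso M Q -> module_iso Q M.
Proof.
case=> f [/is_homE[fx fy] bij_f]; exists f^-1%VF.
have kf : lker f == 0%VS by apply/lker0P; apply: bij_inj.
have fK := lker0_lfunK kf.
have fVK : cancel f^-1%VF f by have [h _ hK] := bij_f; move=> v; rewrite -(hK v) fK.
split; last by exists f.
by apply/is_homE; split=> v; apply: (can_inj fK); rewrite ?fx ?fy !fVK.
Qed.

Lemma module_iso_trans M Q P :
  module_iso M Q -> module_iso Q P -> module_iso M P.
Proof.
case=> f [/is_homE[fx fy] bij_f] [g [/is_homE[gx gy] bij_g]].
exists (g \o f)%VF; split.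
  by apply/is_homE; split=> v; rewrite !comp_lfunE ?fx ?fy ?gx ?gy.
by apply: (eq_bij (bij_comp bij_g bij_f)) => v; rewrite comp_lfunE.
Qed.

Lemma submodule_img M Q (f : 'Hom(carrier M, carrier Q)) B :
    submodule B -> {in B, forall v, f (actx M v) = actx Q (f v)} ->
    {in B, forall v, f (acty M v) = acty Q (f v)} ->
  submodule (f @: B)%VS.
Proof.
case/submoduleP=> Bx By fx fy; apply/submoduleP; split=> _ /memv_imgP[v vB ->].
  by rewrite -fx // memv_img // Bx.
by rewrite -fy // memv_img // By.
Qed.

Lemma submodule_cap M (U W : {vspace carrier M}) :
  submodule U -> submodule W -> submodule (U :&: W)%VS.
Proof.
case/submoduleP=> Ux Uy /submoduleP[Wx Wy]; apply/submoduleP.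
by split=> v /memv_capP[vU vW]; rewrite memv_cap ?Ux ?Wx ?Uy ?Wy.
Qed.

(** Put B = W :&: W'. By simplicity B maps onto both Q and Q'; the kernel of
    B -> Q' is inside that of B -> Q, hence Q is a quotient of Q', and a
    nonzero quotient of a simple module is the module itself. *)
Lemma simple_subquotient_iso M (W U W' U' : {vspace carrier M}) Q Q' :
    submodule W -> submodule W' ->
    is_quotient W U Q -> is_quotient W' U' Q' ->
    simple_module Q -> simple_module Q' ->
    ~~ (W :&: W' <= U)%VS -> (W :&: U' <= U)%VS ->
  module_iso Q Q' /\ (W' <= U' + W :&: W')%VS.
Proof.
move=> sW sW' [f [fx fy fW fU]] [f' [fx' fy' fW' fU']] [Q0 sQ] [Q0' sQ'] nBU WU'U.
set B := (W :&: W')%VS in nBU *.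
have sB : submodule B by apply: submodule_cap.
have BW v : v \in B -> v \in W by case/memv_capP.
have BW' v : v \in B -> v \in W' by case/memv_capP.
have fB : (f @: B)%VS = {:carrier Q}%VS.
  have sfB : submodule (f @: B)%VS by apply: submodule_img => // v /BW; auto.
  have [|//] := sQ _ sfB.
  move/eqP; rewrite -lkerE => /subvP Bf; case/negP: nBU; rewrite -fU.
  by apply/subvP => v vB; rewrite memv_cap BW // Bf.
have fB' : (f' @: B)%VS = {:carrier Q'}%VS.
  have sfB' : submodule (f' @: B)%VS by apply: submodule_img => // v /BW'; auto.
  have [|//] := sQ' _ sfB'.
  move/eqP; rewrite -lkerE => /subvP Bf; case/negP: nBU.
  apply: subv_trans WU'U; rewrite -fU'; apply/subvP => v vB.
  by rewrite !memv_cap BW // BW' // Bf.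
split; last first.
  apply/subvP => w wW; have : f' w \in (f' @: B)%VS by rewrite fB' memvf.
  case/memv_imgP=> b bB fw; rewrite -(subrK b w) memv_add // -fU' memv_cap.
  by rewrite memv_ker linearB /= fw subrr eqxx memvB // BW'.
apply: module_iso_sym.
(* A linear section s of f' with values in B; h = f \o s is then the map
   Q' -> Q induced by f on B modulo the kernel of f'. *)
pose s := (projv B \o (f' \o projv B)^-1)%VF; pose h := (f \o s)%VF.
have sB' q : s q \in B by rewrite comp_lfunE memv_proj.
have sK q : f' (s q) = q.
  rewrite comp_lfunE -[LHS]comp_lfunE limg_lfunVK //.
  by rewrite limg_comp limg_proj fB' memvf.
have hE b : b \in B -> h (f' b) = f b.
  move=> bB; rewrite comp_lfunE; apply/eqP; rewrite -subr_eq0 -linearB /= -memv_ker.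
  have sbB : s (f' b) - b \in B by rewrite memvB.
  have : s (f' b) - b \in (W :&: lker f)%VS.
    rewrite fU; apply: (subvP WU'U); rewrite -fU' !memv_cap (BW _ sbB) (BW' _ sbB).
    by rewrite memv_ker linearB /= sK subrr.
  by case/memv_capP.
have /submoduleP[Bx By] := sB.
have hx q : h (actx Q' q) = actx Q (h q).
  rewrite -(sK q) -fx' ?BW' // hE ?Bx // fx ?BW //.
  by rewrite hE.
have hy q : h (acty Q' q) = acty Q (h q).
  rewrite -(sK q) -fy' ?BW' // hE ?By // fy ?BW //.
  by rewrite hE.
have himg : limg h = {:carrier Q}%VS.
  apply/eqP; rewrite eqEsubv subvf -fB; apply/subvP => _ /memv_imgP[b bB ->].
  by rewrite -hE // memv_img ?memvf.
exists h; split; first exact/is_homE.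
have kh : lker h == 0%VS.
  have skh : submodule (lker h).
    by apply/submoduleP; split=> v; rewrite !memv_ker ?hx ?hy => /eqP->;
      rewrite linear0.
  have [->//|hk] := sQ' _ skh.
  case: Q0; rewrite -himg; apply/eqP; rewrite -lkerE hk; exact: subvv.
exists h^-1%VF; first exact: lker0_lfunK.
by move=> q; apply: limg_lfunVK; rewrite himg memvf.
Qed.

Lemma composition_series_mono M r (F : nat -> {vspace carrier M})
    (S : 'I_r -> amodule k) i j :
  composition_series F S -> (i <= j <= r)%N -> (F i <= F j)%VS.
Proof.
case=> _ _ _ FS; elim: j => [|j IHj] /andP[].
  by rewrite leqn0 => /eqP-> _; apply: subvv.
rewrite leq_eqVlt => /predU1P[-> _|]; first exact: subvv.
rewrite ltnS => ij jr; apply: subv_trans (IHj _) _; first by rewrite ij ltnW.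
by have [] := FS (Ordinal jr).
Qed.

(** To the factor F i.+1 / F i is attached the first step j at which the
    intersection with F i.+1 is not inside F i. The factors F i.+1 / F i and
    G j.+1 / G j are isomorphic, and two indices i < i2 cannot share the same j:
    modulo G j, all of G j.+1 comes from F i.+1, hence from F i2. *)
Lemma composition_series_inj M r r' (F G : nat -> {vspace carrier M})
    (S : 'I_r -> amodule k) (T : 'I_r' -> amodule k) :
    composition_series F S -> composition_series G T ->
  exists2 s : 'I_r -> 'I_r', injective s & forall i, module_iso (S i) (T (s i)).
Proof.
move=> csF csG; have [F0 Fr sF FS] := csF; have [G0 Gr sG GT] := csG.
pose P (i : 'I_r) (j : 'I_r') :=
  ~~ (F i.+1 :&: G j.+1 <= F i)%VS && (F i.+1 :&: G j <= F i)%VS.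
have exP i : exists j, P i j.
  have [FiS [f [_ _ fW fU]] [Si0 _]] := FS i.
  have ex : exists j, ~~ (F i.+1 :&: G j <= F i)%VS.
    exists r'; rewrite Gr capvf; apply/negP => FSi; case: Si0; rewrite -fW.
    by apply/eqP; rewrite -lkerE; apply: subv_trans FSi _; rewrite -fU capvSr.
  case: (ex_minnP ex) => -[|j]; first by rewrite G0 capv0 sub0v.
  move=> nj minj.
  have jr' : (j < r')%N.
    apply: minj; rewrite Gr capvf; case: ex => j'; apply: contra => FSi.
    exact: subv_trans (capvSl _ _) FSi.
  exists (Ordinal jr'); rewrite /P nj /=; apply/negPn/negP => /minj.
  by rewrite ltnn.
have /fin_all_exists[s sP] := exP.
have butterfly i : module_iso (S i) (T (s i)) /\
    (G (s i).+1 <= G (s i) + F i.+1 :&: G (s i).+1)%VS.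
  have [_ qi si] := FS i; have [_ qj sj] := GT (s i); have /andP[nP Pi] := sP i.
  exact: (simple_subquotient_iso (sF _ (ltn_ord i)) (sG _ (ltn_ord (s i))) qi qj).
exists s; last by move=> i; case: (butterfly i).
have ltn_neq (i i2 : 'I_r) : (i < i2)%N -> s i <> s i2.
  move=> ii2 sii2; have [_ /subvP Gs] := butterfly i.
  have /andP[/negP nF /subvP GFi2] := sP i2.
  rewrite -sii2 in nF GFi2; case: nF.
  have Fii2 : (F i.+1 <= F i2)%VS.
    by apply: composition_series_mono csF _; rewrite ii2 ltnW.
  apply/subvP => v /memv_capP[vF vG].
  have /memv_addP[g gG [b /memv_capP[bF _] def_v]] := Gs v vG.
  have bF2 := subvP Fii2 b bF.
  rewrite def_v memvD // GFi2 // memv_cap gG andbT -(addrK b g) -def_v memvB //.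
  by have [/subvP FF _ _] := FS i2; apply: FF.
move=> i i2 sii2; apply/val_inj; case: (ltngtP i i2) => // [/ltn_neq|/ltn_neq] //.
by move/(_ (esym sii2)).
Qed.

Theorem jordan_holder M r r' (S : 'I_r -> amodule k) (T : 'I_r' -> amodule k) :
    composition_factors M S -> composition_factors M T ->
  exists2 s : 'I_r -> 'I_r', bijective s & forall i, module_iso (S i) (T (s i)).
Proof.
move=> [F csF] [G csG]; have [s s_inj sP] := composition_series_inj csF csG.
have [t t_inj _] := composition_series_inj csG csF.
exists s => //; apply: inj_card_bij => //.
exact: leq_card t_inj.
Qed.

Lemma weakly_equivalent_sym M Q :
  weakly_equivalent M Q -> weakly_equivalent Q M.
Proof.
case=> r [S [T [csS csT [s [t stK tsK] sP]]]]; exists r, T, S; split=> //.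
exists t; first by exists s.
by move=> i; apply: module_iso_sym; rewrite -{2}(tsK i).
Qed.

Lemma weakly_equivalent_trans M Q P :
  weakly_equivalent M Q -> weakly_equivalent Q P -> weakly_equivalent M P.
Proof.
move=> [r [S [T [csS csT [s s_bij sP]]]]].
move=> [r' [S' [T' [csS' csT' [s' s_bij' sP']]]]].
have [u u_bij uP] := jordan_holder csT csS'.
have rr' : r = r' by rewrite -(card_ord r) -(card_ord r') (bij_eq_card u_bij).
case: _ / rr' in S' T' csS' csT' s' s_bij' sP' u u_bij uP *.
exists r, S, T'; split=> //; exists (s' \o (u \o s)).
  by apply: bij_comp => //; apply: bij_comp.
by move=> i; apply: module_iso_trans (sP' _); apply: module_iso_trans (uP _).
Qed.

End JordanHolder.

(** * Dimension vectors *)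

Section RankOne.
Variables (k : fieldType) (V Q : vectType k) (phi : {scalar V}) (q : Q).

Definition rank_one (v : V) : Q := phi v *: q.

Fact rank_one_linear : linear rank_one.
Proof. by move=> c u v; rewrite /rank_one linearP scalerDl scalerA. Qed.

HB.instance Definition _ :=
  GRing.isLinear.Build k V Q *:%R rank_one rank_one_linear.

End RankOne.

Section Dimensions.
Variables (k : fieldType) (omega : k).
Hypothesis omega_prim : 3.-primitive_root omega.
Hypothesis sign_prim : 2.-primitive_root (-1 : k).
Implicit Types M Q : amodule k.

Lemma iter_actx M v : iter 3 (actx M) v = v.
Proof. by rewrite /= -!comp_lfunE actx_cube lfunE. Qed.

Lemma iter_acty M v : iter 2 (acty M) v = v.
Proof. by rewrite /= -!comp_lfunE acty_square lfunE. Qed.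

Notation eigx M i := (passmx.leigenspace (actx M) (omega ^+ i)).
Notation eigy M j := (passmx.leigenspace (acty M) ((-1) ^+ j)).

Lemma sum_dimension_vector M a b : has_dimension_vector omega M a b ->
  (\sum_(i < 3) a i = \dim {:carrier M})%N /\
  (\sum_(j < 2) b j = \dim {:carrier M})%N.
Proof.
case=> da db; split.
  rewrite -(sum_dim_leigenspace omega_prim (@iter_actx M)).
  by apply: eq_bigr => i _; rewrite da.
rewrite -(sum_dim_leigenspace sign_prim (@iter_acty M)).
by apply: eq_bigr => i _; rewrite db.
Qed.

(** Exactness of eigenspaces, summed along a composition series. *)
Lemma dim_composition_factors M r (S : 'I_r -> amodule k) :
    composition_factors M S ->
  (forall i : 'I_3, \dim (eigx M i) = \sum_(t < r) \dim (eigx (S t) i))%N /\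
  (forall j : 'I_2, \dim (eigy M j) = \sum_(t < r) \dim (eigy (S t) j))%N.
Proof.
case=> F [F0 Fr sF FS].
have FSx t (tr : (t < r)%N) i (T := S (Ordinal tr)) :
    (\dim (F t.+1 :&: eigx M (i : 'I_3)) =
     \dim (F t :&: eigx M i) + \dim (eigx T i))%N.
  have [_ [f [fx _ fW fU]] _] := FS (Ordinal tr).
  apply: (dim_leigenspace_quotient omega_prim (@iter_actx M) i) fx fW fU.
  by case: (sF t.+1 tr).
have FSy t (tr : (t < r)%N) j (T := S (Ordinal tr)) :
    (\dim (F t.+1 :&: eigy M (j : 'I_2)) =
     \dim (F t :&: eigy M j) + \dim (eigy T j))%N.
  have [_ [f [_ fy fW fU]] _] := FS (Ordinal tr).
  apply: (dim_leigenspace_quotient sign_prim (@iter_acty M) j) fy fW fU.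
  by case: (sF t.+1 tr).
have series (E : {vspace carrier M}) (d : 'I_r -> nat) :
    (forall t (tr : (t < r)%N),
      \dim (F t.+1 :&: E) = \dim (F t :&: E) + d (Ordinal tr))%N ->
  \dim E = (\sum_(t < r) d t)%N.
  move=> dE; pose d' t := if insub t is Some t' then d t' else 0%N.
  have partial t : (t <= r)%N -> \dim (F t :&: E) = (\sum_(s < t) d' s)%N.
    elim: t => [|t IHt] tr; first by rewrite F0 cap0v dimv0 big_ord0.
    by rewrite big_ord_recr /= (dE _ tr) IHt ?(ltnW tr) // /d' insubT.
  have := partial r (leqnn r); rewrite Fr capfv => ->.
  by apply: eq_bigr => t _; rewrite /d' valK.
by split=> i; apply: series => t tr; [apply: FSx | apply: FSy].
Qed.

(** When the two eigenspaces are too large to be independent, the common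
    eigenvector v spans a one-dimensional submodule, and, dually, M maps onto
    the module with the same eigenvalues because the images of actx - c and of
    acty - d do not span M. The composite M -> k v -> M is an endomorphism of
    rank one. *)
Lemma endo_trivial_eigenspaces M c d :
    endo_ring_trivial M ->
    (\dim {:carrier M} < \dim (passmx.leigenspace (actx M) c)
                         + \dim (passmx.leigenspace (acty M) d))%N ->
  (\dim {:carrier M} <= 1)%N.
Proof.
case=> phi [phi1 _ _ phiP].
set E := passmx.leigenspace _ _; set E' := passmx.leigenspace _ _ => ltEE'.
have /subvPn[v vEE' v0] : ~~ (E :&: E' <= 0)%VS.
  apply: contraTN ltEE'; rewrite subv0 => /eqP EE'0; rewrite -leqNgt.
  by rewrite -dimv_sum_cap EE'0 dimv0 addn0 dimvS ?subvf.
have /memv_capP[] := vEE'; rewrite !memv_leigenspace => /eqP vx /eqP vy.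
pose X : 'End(carrier M) := actx M - c *: \1%VF.
pose Y : 'End(carrier M) := acty M - d *: \1%VF.
pose I := (limg X + limg Y)%VS.
have /subvPn[w _ wI] : ~~ ({:carrier M} <= I)%VS.
  apply: contraTN ltEE' => /dimvS leI; rewrite -leqNgt.
  have dX : (\dim E + \dim (limg X))%N = \dim {:carrier M}.
    by rewrite -(limg_ker_dim X fullv) capfv.
  have dY : (\dim E' + \dim (limg Y))%N = \dim {:carrier M}.
    by rewrite -(limg_ker_dim Y fullv) capfv.
  have [dI _] := dimv_add_leqif (limg X) (limg Y).
  rewrite -(leq_add2r (\dim (limg X) + \dim (limg Y))) addnACA dX dY leq_add2l.
  exact: leq_trans leI dI.
(* A vector outside I, corrected so that its projection to I vanishes: g is
   the coordinate along w' of the projection away from I, times v. *)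
pose w' := w - projv I w.
have w'0 : w' != 0.
  by apply: contraNneq wI => /eqP; rewrite subr_eq0 => /eqP->; apply: memv_proj.
pose g := (linfun (rank_one (coord [tuple w'] ord0) v) \o (\1 - projv I))%VF.
have gE u : g u = coord [tuple w'] ord0 (u - projv I u) *: v.
  by rewrite comp_lfunE !lfun_simp.
have gI u : u \in I -> g u = 0.
  by move=> uI; rewrite gE projv_id // subrr linear0 scale0r.
have gw : g w = v.
  have cw : coord [tuple w'] ord0 w' = 1.
    by have := @coord_free _ _ _ [tuple w'] ord0 ord0; rewrite seq1_free => ->.
  by rewrite gE cw scale1r.
have gx u : g (actx M u) = c *: g u.
  apply/eqP; rewrite -linearZ -subr_eq0 -linearB /= gI //.
  have -> : actx M u - c *: u = X u by rewrite !lfun_simp.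
  by apply: (subvP (addvSl _ _)); rewrite memv_img ?memvf.
have gy u : g (acty M u) = d *: g u.
  apply/eqP; rewrite -linearZ -subr_eq0 -linearB /= gI //.
  have -> : acty M u - d *: u = Y u by rewrite !lfun_simp.
  by apply: (subvP (addvSr _ _)); rewrite memv_img ?memvf.
have /phiP[e def_g] : is_hom g.
  apply/is_homE; split=> u; rewrite ?gx ?gy gE.
    by rewrite [RHS]linearZ /= vx !scalerA mulrC.
  by rewrite [RHS]linearZ /= vy !scalerA mulrC.
have gM u : g u = e *: u.
  have -> : g = e *: \1%VF.
    by rewrite def_g -phi1 -linearZ; congr (phi _); rewrite /GRing.scale /= mulr1.
  by rewrite !lfun_simp.
have e0 : e != 0.
  apply: contraNneq v0 => e0; rewrite memv0 -gw gM e0 scale0r eqxx //.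
have -> : {:carrier M}%VS = <[v]>%VS.
  apply/eqP; rewrite eqEsubv subvf andbT; apply/subvP => u _.
  apply/vlineP; exists (e^-1 * coord [tuple w'] ord0 (u - projv I u)).
  by rewrite -scalerA -gE gM scalerA mulVf ?scale1r.
by rewrite dim_vline; case: (v != 0).
Qed.

(** A dimension vector with b j + 2 <= a i would force, against the eigenvalue
    of y other than the j-th one, a rank one endomorphism. *)
Lemma schur_root_bound a b i j : schur_root omega a b -> (a i <= (b j).+1)%N.
Proof.
case=> M [dM eM]; have [sa sb] := sum_dimension_vector dM; have [da db] := dM.
have [//|ltba] := leqP (a i) (b j).+1.
(* In 'I_2, rev_ord exchanges the two indices. *)
have := @endo_trivial_eigenspaces M _ _ eM; move/(_ (omega ^+ i)).
move/(_ ((-1) ^+ (rev_ord j))); rewrite da db => lea.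
have := sb; have -> : (\sum_(j < 2) b j = b j + b (rev_ord j))%N.
  rewrite big_ord_recl big_ord1; case: j {ltba lea} => -[|[|//]] j2.
    by congr (b _ + b _)%N; apply: val_inj.
  by rewrite addnC; congr (b _ + b _)%N; apply: val_inj.
have : (a i <= \dim {:carrier M})%N by rewrite -sa (bigD1 i) ?leq_addr.
by move: lea; set n := \dim _; lia.
Qed.

End Dimensions.

(** * Split modules and the classification of weak classes *)

Section DiagonalMap.
Variables (k : fieldType) (r : nat).
Implicit Types c : 'I_r -> k.

Definition diag_lfun c : 'End('rV[k]_r) := linfun (mulmxr (diag_mx (\row_t c t))).

Lemma diag_lfunE c v t : diag_lfun c v 0 t = v 0 t * c t.
Proof. by rewrite lfunE /= mul_mx_diag !mxE. Qed.

(** The t-th coordinate, with values in row vectors so as to be a map to a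
    split module with one factor. *)
Definition row_coord (t : 'I_r) : 'Hom('rV[k]_r, 'rV[k]_1) :=
  linfun (mulmxr (delta_mx t 0)).

Lemma row_coordE t v : row_coord t v = (v 0 t)%:M.
Proof.
rewrite lfunE /=; apply/rowP => i; rewrite !mxE ord1 (bigD1 t) //= !mxE.
by rewrite !eqxx mulr1 big1 ?addr0 // => s /negPf st; rewrite mxE st mulr0.
Qed.

End DiagonalMap.

Section SplitModules.
Variables (k : fieldType) (omega : k).
Hypothesis omega_prim : 3.-primitive_root omega.
Hypothesis sign_prim : 2.-primitive_root (-1 : k).
Implicit Types M Q : amodule k.

(** The types of one-dimensional modules: (i, j) stands for the one on which x
    and y act by omega ^+ i and (-1) ^+ j. *)
Notation char_type := ('I_3 * 'I_2)%type.

Fact diag_cube r (tau : 'I_r -> char_type)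
    (X := diag_lfun (fun t => omega ^+ (tau t).1)) :
  (X \o X \o X)%VF = \1%VF.
Proof.
apply/lfunP => v; apply/rowP => t; rewrite !comp_lfunE !diag_lfunE lfunE /=.
by rewrite -!mulrA -expr2 -exprS -exprM mulnC exprM
           (prim_expr_order omega_prim) expr1n mulr1.
Qed.

Fact diag_square r (tau : 'I_r -> char_type)
    (Y := diag_lfun (fun t => (-1 : k) ^+ (tau t).2)) :
  (Y \o Y)%VF = \1%VF.
Proof.
apply/lfunP => v; apply/rowP => t; rewrite !comp_lfunE !diag_lfunE lfunE /=.
by rewrite -mulrA -expr2 sqrr_sign mulr1.
Qed.

Definition split_module r (tau : 'I_r -> char_type) : amodule k :=
  AModule (diag_cube tau) (diag_square tau).

Definition char_module (p : char_type) := split_module (fun _ : 'I_1 => p).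

Lemma dim_char_module p : \dim {:carrier (char_module p)} = 1%N.
Proof. by rewrite dimvf dim_matrix. Qed.

Lemma actx_char p v : actx (char_module p) v = omega ^+ p.1 *: v.
Proof. by apply/rowP => t; rewrite diag_lfunE mxE mulrC. Qed.

Lemma acty_char p v : acty (char_module p) v = (-1) ^+ p.2 *: v.
Proof. by apply/rowP => t; rewrite diag_lfunE mxE mulrC. Qed.

Lemma dim1_simple M : \dim {:carrier M} = 1%N -> simple_module M.
Proof.
move=> dM; split=> [M0|U _]; first by rewrite M0 dimv0 in dM.
have := dimvS (subvf U); rewrite dM leq_eqVlt ltnS leqn0 dimv_eq0.
by case/orP=> /eqP dU; [right|left=> //]; apply/eqP; rewrite eqEdim subvf dM dU.
Qed.

Lemma dim_leigenspace_scalar (V : vectType k) (g : 'End(V)) c d :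
    (forall v, g v = c *: v) -> \dim {:V} = 1%N ->
  \dim (passmx.leigenspace g d) = (c == d).
Proof.
move=> gc dV; case: eqP => [<-|/eqP cd].
  rewrite -[RHS]dV; congr (\dim _); apply/vspaceP => v.
  by rewrite memv_leigenspace gc eqxx memvf.
apply/eqP; rewrite dimv_eq0 -subv0; apply/subvP => v.
rewrite memv_leigenspace gc -subr_eq0 -scalerBl scaler_eq0 subr_eq0 (negPf cd).
by rewrite memv0.
Qed.

Lemma dim_leigenspace_iso M p : module_iso M (char_module p) ->
  (forall i : 'I_3, \dim (passmx.leigenspace (actx M) (omega ^+ i)) = (p.1 == i)) /\
  (forall j : 'I_2, \dim (passmx.leigenspace (acty M) ((-1) ^+ j)) = (p.2 == j)).
Proof.
case=> f [/is_homE[fx fy] bij_f]; have f_inj := bij_inj bij_f.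
have dM : \dim {:carrier M} = 1%N.
  rewrite -(dim_char_module p) -(limg_dim_eq (f := f)); last first.
    by rewrite capfv; apply/eqP/lker0P.
  congr (\dim _); apply/vspaceP => q; rewrite memvf.
  by case: bij_f => h _ hK; rewrite -(hK q) memv_img ?memvf.
split=> i.
  rewrite (dim_leigenspace_scalar (c := omega ^+ p.1)) // => [|v].
    by congr nat_of_bool; apply/eqP/eqP => [/(prim_expr_inj omega_prim)|->].
  by apply: f_inj; rewrite fx linearZ /= actx_char.
rewrite (dim_leigenspace_scalar (c := (-1) ^+ p.2)) // => [|v].
  by congr nat_of_bool; apply/eqP/eqP => [/(prim_expr_inj sign_prim)|->].
by apply: f_inj; rewrite fy linearZ /= acty_char.
Qed.

Lemma char_module_inj p q : module_iso (char_module p) (char_module q) -> p = q.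
Proof.
move=> pq; have id_iso : module_iso (char_module p) (char_module p).
  exists \1%VF; split; first by apply/is_homE; split=> v; rewrite !lfunE.
  by exists id => v; rewrite lfunE.
have [px py] := dim_leigenspace_iso id_iso; have [qx qy] := dim_leigenspace_iso pq.
have := qx p.1; rewrite px eqxx; have := qy p.2; rewrite py eqxx.
case: p q {pq id_iso px py qx qy} => p1 p2 [q1 q2] /=.
by case: eqP => // -> _; case: eqP => // ->.
Qed.

Lemma dim1_char_module M : \dim {:carrier M} = 1%N ->
  exists p, module_iso M (char_module p).
Proof.
move=> dM; pose e := vpick {:carrier M}.
have e0 : e != 0 by rewrite vpick0 -dimv_eq0 dM.
have eM v : exists a, v = a *: e.
  apply/vlineP; suff -> : <[e]>%VS = {:carrier M}%VS by apply: memvf.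
  by apply/eqP; rewrite eqEdim subvf dM dim_vline e0.
have cancel_e a b : a *: e = b *: e -> a = b.
  move/eqP; rewrite -subr_eq0 -scalerBl scaler_eq0 subr_eq0 (negPf e0) orbF.
  by move/eqP.
have [lx ex] := eM (actx M e); have [ly ey] := eM (acty M e).
have xE a : actx M (a *: e) = (a * lx) *: e by rewrite linearZ /= ex scalerA.
have yE a : acty M (a *: e) = (a * ly) *: e by rewrite linearZ /= ey scalerA.
have lx3 : lx ^+ 3 = 1.
  apply: cancel_e; rewrite scale1r -[RHS](iter_actx e) /= ex !xE.
  by rewrite !exprSr expr0 mul1r.
have ly2 : ly ^+ 2 = 1.
  apply: cancel_e; rewrite scale1r -[RHS](iter_acty e) /= ey yE.
  by rewrite expr2.
have [i def_lx] := prim_rootP omega_prim lx3.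
have [j def_ly] := prim_rootP sign_prim ly2.
exists (i, j).
have coord_e a : coord [tuple e] ord0 (a *: e) = a.
  rewrite linearZ /=; have := @coord_free _ _ _ [tuple e] ord0 ord0.
  by rewrite seq1_free => ->; rewrite // mulr1.
pose f : 'Hom(carrier M, 'rV[k]_1) :=
  linfun (rank_one (coord [tuple e] ord0) (const_mx 1)).
have fE a : f (a *: e) = a *: const_mx 1 by rewrite lfunE -[in RHS](coord_e a).
exists f; split.
  apply/is_homE; split=> v; have [a ->] := eM v; rewrite ?actx_char ?acty_char.
    by rewrite xE !fE def_lx scalerA mulrC.
  by rewrite yE !fE def_ly scalerA mulrC.
exists (fun v : 'rV[k]_1 => v 0 0 *: e) => v.
  by have [a ->] := eM v; rewrite fE !mxE mulr1.
by rewrite fE; apply/rowP => t; rewrite !mxE mulr1 ord1.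
Qed.


Lemma split_module_factors r (tau : 'I_r -> char_type) :
  composition_factors (split_module tau) (fun t => char_module (tau t)).
Proof.
(* F s consists of the vectors supported on the first s coordinates. *)
pose F (s : nat) := lker (diag_lfun (fun t : 'I_r => (s <= t)%N%:R : k)).
have memF s (v : 'rV[k]_r) :
    reflect (forall t : 'I_r, (s <= t)%N -> v 0 t = 0) (v \in F s).
  rewrite memv_ker; apply: (iffP eqP) => [v0 t st | v0].
    by have /rowP/(_ t) := v0; rewrite diag_lfunE st mulr1 mxE.
  apply/rowP => t; rewrite diag_lfunE mxE.
  by case: leqP => [/v0->|]; rewrite (mul0r, mulr0).
have Fsub s : submodule (M := split_module tau) (F s).
  by apply/submoduleP; split=> v /memF v0; apply/memF => t /v0 vt0;
    rewrite diag_lfunE vt0 mul0r.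
exists F; split=> //.
- apply/eqP; rewrite -subv0; apply/subvP => v /memF v0; rewrite memv0.
  by apply/eqP/rowP => t; rewrite v0 ?mxE.
- by apply/vspaceP => v; rewrite memvf; apply/memF => t; rewrite leqNgt ltn_ord.
move=> t; split; last exact/dim1_simple/dim_char_module.
  by apply/subvP => v /memF v0; apply/memF => s /ltnW/v0.
exists (row_coord k t); split.
- move=> v _; rewrite row_coordE actx_char diag_lfunE row_coordE mulrC.
  by rewrite scale_scalar_mx.
- move=> v _; rewrite row_coordE acty_char diag_lfunE row_coordE mulrC.
  by rewrite scale_scalar_mx.
- apply/eqP; rewrite eqEsubv subvf; apply/subvP => v _; apply/memv_imgP.
  exists (v 0 0 *: delta_mx 0 t).
    apply/memF => s ts; rewrite !mxE eqxx /=.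
    by case: eqP ts => [->|_]; [rewrite ltnn | rewrite mulr0].
  by rewrite row_coordE !mxE !eqxx mulr1 -mx11_scalar.
apply/vspaceP => v; rewrite memv_cap memv_ker row_coordE.
apply/andP/memF => [[/memF v0 /eqP vt] s|v0].
  rewrite leq_eqVlt => /predU1P[/val_inj<-|/v0//].
  by have /rowP/(_ 0) := vt; rewrite !mxE eqxx.
split; first by apply/memF => s /ltnW/v0.
by rewrite v0 // raddf0.
Qed.

Lemma split_module_mie r (tau : 'I_r -> char_type) :
  maximally_iterated_extension (split_module tau).
Proof.
exists r, (fun t => char_module (tau t)); split; first exact: split_module_factors.
by move=> t; apply: dim_char_module.
Qed.

(** The dimension vector of a module with one-dimensional composition factors
    is read off their types: an entry is the sum of a row or of a column of the
    matrix of multiplicities. *)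
Lemma dimension_vector_factors M r (S : 'I_r -> amodule k) tau a b :
    composition_factors M S ->
    (forall t, module_iso (S t) (char_module (tau t))) ->
  has_dimension_vector omega M a b <->
    (forall i, a i = count (fun p => p.1 == i) (codom tau)) /\
    (forall j, b j = count (fun p => p.2 == j) (codom tau)).
Proof.
move=> csS iso_S; have [dx dy] := dim_composition_factors omega_prim sign_prim csS.
have cE (P : pred char_type) (d : 'I_r -> nat) :
    (forall t, d t = P (tau t)) -> (\sum_(t < r) d t)%N = count P (codom tau).
  move=> dP; rewrite -sum1_count big_image_cond [RHS]big_mkcond.
  by apply: eq_bigr => t _; rewrite dP; case: (P _).
have {}dx (i : 'I_3) : \dim (passmx.leigenspace (actx M) (omega ^+ i)) =
    count (fun p : char_type => p.1 == i) (codom tau).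
  by rewrite dx; apply: cE => t; have [-> _] := dim_leigenspace_iso (iso_S t).
have {}dy (j : 'I_2) : \dim (passmx.leigenspace (acty M) ((-1) ^+ j)) =
    count (fun p : char_type => p.2 == j) (codom tau).
  by rewrite dy; apply: cE => t; have [_ ->] := dim_leigenspace_iso (iso_S t).
split=> [[da db]|[da db]]; split.
- by move=> i; rewrite -da dx.
- by move=> j; rewrite -db dy.
- by move=> i; rewrite da dx.
- by move=> j; rewrite db dy.
Qed.

Lemma module_iso_refl M : module_iso M M.
Proof.
exists \1%VF; split; first by apply/is_homE; split=> v; rewrite !lfunE.
by exists id => v; rewrite lfunE.
Qed.

Lemma dimension_vector_split r (tau : 'I_r -> char_type) a b :
  has_dimension_vector omega (split_module tau) a b <->
    (forall i, a i = count (fun p => p.1 == i) (codom tau)) /\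
    (forall j, b j = count (fun p => p.2 == j) (codom tau)).
Proof.
by apply: dimension_vector_factors (split_module_factors tau) _ => t;
  apply: module_iso_refl.
Qed.

Lemma mie_split M : maximally_iterated_extension M ->
  exists r (tau : 'I_r -> char_type), weakly_equivalent M (split_module tau) /\
    forall a b, has_dimension_vector omega M a b ->
      has_dimension_vector omega (split_module tau) a b.
Proof.
case=> r [S [csS dS]].
have /fin_all_exists[tau tauP] := fun t => dim1_char_module (dS t).
exists r, tau; split.
  exists r, S, (fun t => char_module (tau t)); split=> //.
    exact: split_module_factors.
  by exists id => //; exists id.
by move=> a b /(dimension_vector_factors _ _ csS tauP)/dimension_vector_split.
Qed.

(** Jordan-Hölder matches the types of the two modules one by one, as distinct
    types give non-isomorphic modules; conversely, a permutation of the types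
    matches the factors. *)
Lemma weakly_equivalent_split r r' (tau : 'I_r -> char_type)
    (tau' : 'I_r' -> char_type) :
  weakly_equivalent (split_module tau) (split_module tau') <->
  perm_eq (codom tau) (codom tau').
Proof.
split=> [[n [S [T [csS csT [s s_bij sP]]]]]|tt'].
  have [u u_bij uP] := jordan_holder (split_module_factors tau) csS.
  have [u' u_bij' uP'] := jordan_holder csT (split_module_factors tau').
  pose w := u' \o (s \o u).
  have w_bij : bijective w by do 2!apply: bij_comp => //.
  have tauE : tau =1 tau' \o w.
    move=> t; apply: char_module_inj; apply: module_iso_trans (uP' _).
    exact: module_iso_trans (sP _).
  rewrite /codom /image_mem (eq_map tauE) map_comp; apply: perm_map.
  apply: uniq_perm; rewrite ?enum_uniq ?(map_inj_uniq (bij_inj w_bij)) //.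
    exact: enum_uniq.
  move=> t; rewrite mem_enum; apply/mapP; have [w' _ wK] := w_bij.
  by exists (w' t); rewrite ?mem_enum ?wK.
have rr' : r = r' by have := perm_size tt'; rewrite !size_codom !card_ord.
case: _ / rr' in tau' tt' *.
have /tuple_permP[p /val_inj tauE] :
  perm_eq [tuple tau t | t < r] [tuple tau' t | t < r] by [].
exists r, (fun t => char_module (tau t)), (fun t => char_module (tau' t)).
split; try exact: split_module_factors.
exists p; first exact: injF_bij perm_inj.
move=> t; have /(congr1 (fun u => tnth u t)) := tauE.
by rewrite !tnth_mktuple => ->; apply: module_iso_refl.
Qed.

End SplitModules.

(** * Counting matrices with prescribed margins *)

Lemma sum_ltn_sub u A :
  (2 * (\sum_(c < A) (u - c)) + (u - A) * (u - A).+1 = u * u.+1)%N.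
Proof.
elim: A => [|A IHA]; first by rewrite big_ord0 subn0.
rewrite big_ord_recr /= -IHA; set S := (\sum_(c < A) (u - c))%N.
have [uA|Au] := leqP u A.
  have -> : (u - A = 0)%N by lia.
  have -> : (u - A.+1 = 0)%N by lia.
  lia.
have -> : (u - A = (u - A.+1).+1)%N by lia.
lia.
Qed.

(** The sum counts the pairs (c, c') with c < A, c' < B and c + c' + 1 = u; it is
    an inclusion-exclusion with truncated subtractions, valid also for u = 0. *)
Lemma count_pairs u A B :
  (\sum_(c < A) ((c < u) && (u - c <= B)) + (u - A) + (u - B) = u + (u - A - B))%N.
Proof.
elim: A => [|A IHA]; first by rewrite big_ord0; lia.
rewrite big_ord_recr /=; move: (bigop _ _ _) IHA => S IHA.
by case: ltnP => ? /=; first case: leqP => ? /=; lia.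
Qed.

(** The third component is determined by the two others; the sum over c' is that
    of [count_pairs] for u = s + 1 - c. *)
Lemma card_triples A0 A1 A2 s :
  #|[set t : 'I_A0 * 'I_A1 * 'I_A2 | (t.1.1 + t.1.2 + t.2 == s)%N]| =
  (\sum_(c < A0) \sum_(c' < A1) ((c' < s.+1 - c) && (s.+1 - c - c' <= A2)))%N.
Proof.
rewrite -sum1dep_card big_mkcond /= pair_big.
rewrite -(pair_big xpredT xpredT
  (fun (p : 'I_A0 * 'I_A1) (c : 'I_A2) =>
  if (p.1 + p.2 + c == s)%N then 1%N else 0%N)) /=.
apply: eq_bigr => -[c c'] _ /=.
have [/andP[lts leA]|out] := boolP (_ && _).
  have ltA : (s - c - c' < A2)%N by lia.
  rewrite (bigD1 (Ordinal ltA)) //= big1 => [|e /eqP ne].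
    by rewrite ifT //; lia.
  by rewrite ifF //; apply/eqP => def_s; apply: ne; apply: val_inj => /=; lia.
by rewrite big1 // => e _; rewrite ifF //; have := ltn_ord e; lia.
Qed.

(** Inclusion-exclusion over the three upper bounds. With K(v) = v (v + 1),
    K(s + 1) is twice the number of all triples of natural numbers of sum s, and
    K(s - a_i) twice the number of those whose i-th component exceeds a_i; the
    hypotheses say that no two bounds can be exceeded at once. *)
Lemma card_bounded_triples a0 a1 a2 s :
    (s <= (a0 + a1).+1 -> s <= (a0 + a2).+1 -> s <= (a1 + a2).+1 ->
  2 * #|[set t : 'I_a0.+1 * 'I_a1.+1 * 'I_a2.+1 | (t.1.1 + t.1.2 + t.2 == s)%N]|
    + (s - a0) * (s - a0).+1 + (s - a1) * (s - a1).+1 + (s - a2) * (s - a2).+1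
  = s.+1 * s.+2)%N.
Proof.
move=> s01 s02 s12; rewrite card_triples; set C := bigop _ _ _.
have : (C + \sum_(c < a0.+1) (s - a1 - c) + \sum_(c < a0.+1) (s - a2 - c)
        = \sum_(c < a0.+1) (s.+1 - c))%N.
  rewrite -!big_split /=; apply: eq_bigr => c _.
  have := count_pairs (s.+1 - c) a1.+1 a2.+1.
  by move: (bigop _ _ _) => S; lia.
have := sum_ltn_sub (s - a1) a0.+1; have := sum_ltn_sub (s - a2) a0.+1.
have := sum_ltn_sub s.+1 a0.+1.
have -> : (s - a1 - a0.+1 = 0)%N by lia.
have -> : (s - a2 - a0.+1 = 0)%N by lia.
rewrite subSS; move: C (bigop _ _ _) (bigop _ _ _) (bigop _ _ _) => C S0 S2 S1.
lia.
Qed.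

Section Multiplicities.
Variable T : finType.
Implicit Types (m : T -> nat) (s : seq T).

Definition seq_of_mult m := flatten [seq nseq (m x) x | x <- enum T].

Lemma count_seq_of_mult m x : count_mem x (seq_of_mult m) = m x.
Proof.
rewrite count_flatten -map_comp sumnE big_map big_enum /= (bigD1 x) //=.
rewrite count_nseq /= eqxx mul1n big1 ?addn0 // => y /negPf yx.
by rewrite count_nseq /= yx.
Qed.

Lemma perm_count_mem s s' :
  (forall x, count_mem x s = count_mem x s') -> perm_eq s s'.
Proof. by move=> ss'; apply/allP => x _; apply/eqP/ss'. Qed.

End Multiplicities.

(** * Matrices of multiplicities *)

Local Notation o0 := (@Ordinal 3 0 isT).
Local Notation o1 := (@Ordinal 3 1 isT).
Local Notation o2 := (@Ordinal 3 2 isT).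
Local Notation s0 := (@Ordinal 2 0 isT).
Local Notation s1 := (@Ordinal 2 1 isT).

Lemma big_ord3 (R : Type) (idx : R) (op : Monoid.law idx) (f : 'I_3 -> R) :
  \big[op/idx]_(i < 3) f i = op (op (f o0) (f o1)) (f o2).
Proof.
rewrite !big_ord_recr big_ord0 /= Monoid.mul1m.
by congr (op (op (f _) (f _)) (f _)); apply: val_inj.
Qed.

Lemma big_ord2 (R : Type) (idx : R) (op : Monoid.law idx) (f : 'I_2 -> R) :
  \big[op/idx]_(j < 2) f j = op (f s0) (f s1).
Proof.
rewrite !big_ord_recr big_ord0 /= Monoid.mul1m.
by congr (op (f _) (f _)); apply: val_inj.
Qed.

Lemma ord3P (P : 'I_3 -> Prop) : P o0 -> P o1 -> P o2 -> forall i, P i.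
Proof.
move=> P0 P1 P2 [[|[|[|//]]] lt_i]; [move: P0|move: P1|move: P2];
  by congr P; apply: val_inj.
Qed.

Lemma ord2P (P : 'I_2 -> Prop) : P s0 -> P s1 -> forall j, P j.
Proof.
by move=> P0 P1 [[|[|//]] lt_j]; [move: P0|move: P1]; congr P; apply: val_inj.
Qed.

Lemma count_fst i (s : seq ('I_3 * 'I_2)) :
  count (fun p => p.1 == i) s = (count_mem (i, s0) s + count_mem (i, s1) s)%N.
Proof.
elim: s => //= -[i' j'] s ->; rewrite !xpair_eqE /=.
by move: j'; apply: ord2P; rewrite /= ?eqE /= ?andbT ?andbF; lia.
Qed.

Lemma count_snd j (s : seq ('I_3 * 'I_2)) :
  count (fun p => p.2 == j) s =
  (count_mem (o0, j) s + count_mem (o1, j) s + count_mem (o2, j) s)%N.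
Proof.
elim: s => //= -[i' j'] s ->; rewrite !xpair_eqE /=.
by move: i'; apply: ord3P; rewrite /= ?eqE /= ?andbT ?andbF; lia.
Qed.

(** The truncated differences become integer polynomials: the factor
    (b0 - a) (b0 - a + 1) vanishes in the limit case a = b0 + 1 as well. *)
Lemma two_mul_card_triples a0 a1 a2 b0 b1 (n := (a0 + a1 + a2)%N) :
    n = (b0 + b1)%N ->
    (a0 <= b0.+1)%N -> (a1 <= b0.+1)%N -> (a2 <= b0.+1)%N ->
    (a0 <= b1.+1)%N -> (a1 <= b1.+1)%N -> (a2 <= b1.+1)%N ->
  (#|[set t : 'I_a0.+1 * 'I_a1.+1 * 'I_a2.+1
       | (t.1.1 + t.1.2 + t.2 == b0)%N]|%:Z * 2
  = 1 + n%:Z ^+ 2 - (a0%:Z ^+ 2 + a1%:Z ^+ 2 + a2%:Z ^+ 2)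
      - (b0%:Z ^+ 2 + b1%:Z ^+ 2) + n%:Z + 1).
Proof.
move=> nE a0b a1b a2b a0b' a1b' a2b'; rewrite /n in nE *.
have b01 : (b0 <= (a0 + a1).+1)%N by lia.
have b02 : (b0 <= (a0 + a2).+1)%N by lia.
have b12 : (b0 <= (a1 + a2).+1)%N by lia.
have := card_bounded_triples b01 b02 b12; move: #|_| => C.
have KZ a : (a <= b0.+1)%N ->
    ((b0 - a) * (b0 - a).+1)%N%:Z = (b0%:Z - a%:Z) * (b0%:Z - a%:Z + 1).
  rewrite leq_eqVlt => /predU1P[->|].
    by rewrite (_ : b0 - b0.+1 = 0)%N; lia.
  by rewrite ltnS => ab; rewrite PoszM -addn1 PoszD -subzn.
move/(congr1 Posz); rewrite !PoszD !KZ // !PoszM -[b0.+2]addn2 -[b0.+1]addn1 !PoszD.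
have -> : b1%:Z = a0%:Z + a1%:Z + a2%:Z - b0%:Z by lia.
lra.
Qed.

Lemma codom_tnth (T : Type) n (t : n.-tuple T) : codom (tnth t) = t.
Proof. exact: map_tnth_enum. Qed.

Lemma sign_prim_root (k : fieldType) :
  [pchar k] =i pred0 -> 2.-primitive_root (-1 : k).
Proof.
move/pcharf0P=> char0; apply/andP; split=> //; apply/forallP=> -[[|[|//]] lt_i].
  rewrite unity_rootE expr1 /= eqbF_neg -subr_eq0 -opprD oppr_eq0.
  by rewrite -[1 + 1]/(2%:R) char0.
by rewrite unity_rootE sqrrN expr1n !eqxx.
Qed.

(** The matrix with first column c and row sums a; the truncated subtraction is
    meant for c i <= a i. *)
Definition col_mult (a c : 'I_3 -> nat) (p : 'I_3 * 'I_2) : nat :=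
  if p.2 == s0 then c p.1 else (a p.1 - c p.1)%N.

Definition triple_fun A0 A1 A2 (t : 'I_A0 * 'I_A1 * 'I_A2) (i : 'I_3) : nat :=
  nth 0%N [:: t.1.1 : nat; t.1.2 : nat; t.2 : nat] i.

(** * The number of weak equivalence classes *)

Theorem proposition4p1 (k : closedFieldType) (char0 : [pchar k] =i pred0)
    (omega : k) (omega_prim : 3.-primitive_root omega)
    (a : 'I_3 -> nat) (b : 'I_2 -> nat) (schur : schur_root omega a b) :
  let n : nat := (\sum_(i < 3) a i)%N in
  let d : int := 1 + n%:Z ^+ 2 - \sum_(i < 3) (a i)%:Z ^+ 2
                               - \sum_(j < 2) (b j)%:Z ^+ 2 in
  n = (\sum_(j < 2) b j)%N /\
  exists N : nat,
    N%:R = (d + n%:Z + 1)%:~R / 2 :> rat /\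
    has_cardinal (mie_weak_classes omega a b) N.
Proof.
have sign_prim := sign_prim_root char0.
move=> n d.
have nE : n = (\sum_(j < 2) b j)%N.
  have [M [dM _]] := schur.
  by have [na nb] := sum_dimension_vector omega_prim sign_prim dM; rewrite /n na nb.
split=> //.
pose X := [set t : 'I_(a o0).+1 * 'I_(a o1).+1 * 'I_(a o2).+1
             | (t.1.1 + t.1.2 + t.2 == b s0)%N].
exists #|X|; split.
  have bound i j := schur_root_bound omega_prim sign_prim i j schur.
  have nE' : (a o0 + a o1 + a o2 = b s0 + b s1)%N.
    by have := nE; rewrite /n big_ord3 big_ord2.
  have cardX := two_mul_card_triples nE' (bound _ _) (bound _ _) (bound _ _)
    (bound _ _) (bound _ _) (bound _ _).
  have -> : d + n%:Z + 1 = #|X|%:Z * 2.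
    by rewrite cardX /d /n !big_ord3 big_ord2.
  by rewrite rmorphM /= mulfK.
pose mult t := col_mult a (@triple_fun (a o0).+1 (a o1).+1 (a o2).+1 t).
pose tau t := tnth (in_tuple (seq_of_mult (mult t))).
have count_tau t p : count_mem p (codom (tau t)) = mult t p.
  by rewrite codom_tnth count_seq_of_mult.
pose S t := split_module omega_prim (tau t).
have S_refl t : weakly_equivalent (S t) (S t).
  by apply/(weakly_equivalent_split omega_prim sign_prim)/perm_refl.
have S_dim t : t \in X -> has_dimension_vector omega (S t) a b.
  rewrite inE => /eqP sum_t; apply/(dimension_vector_split omega_prim sign_prim).
  have t_le i : (triple_fun t i <= a i)%N.
    by move: i; apply: ord3P; rewrite -ltnS ltn_ord.
  split=> [i|j].
    by rewrite count_fst !count_tau /mult /col_mult /= subnKC.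
  rewrite count_snd !count_tau /mult /col_mult /=; move: j; apply: ord2P => //=.
  have := t_le o0; have := t_le o1; have := t_le o2; rewrite /triple_fun /=.
  by have := nE; rewrite big_ord2 /n big_ord3 -sum_t /=; lia.
exists (fun i => weak_class (S (enum_val i))); split=> [i i' ii'|C].
  have /(weakly_equivalent_split omega_prim sign_prim)/seq.permP tt' :
      weakly_equivalent (S (enum_val i)) (S (enum_val i')).
    by have := S_refl (enum_val i'); rewrite -[weakly_equivalent _]ii'.
  have tE j : triple_fun (enum_val i) j = triple_fun (enum_val i') j.
    by have := tt' (pred1 (j, s0)); rewrite !count_tau.
  apply: enum_val_inj; move: (tE o0) (tE o1) (tE o2); rewrite /triple_fun /=.
  case: (enum_val i) (enum_val i') => [[x y] z] [[x' y'] z'] /=.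
  by do 3!move/val_inj->.
split=> [[M [mM dM defC]]|[i ->]]; last first.
  exists (S (enum_val i)); split=> //; first exact: split_module_mie.
  by apply: S_dim; apply: enum_valP.
have [r [sigma [Msigma dsigma]]] := mie_split omega_prim sign_prim mM.
have /(dimension_vector_split omega_prim sign_prim)[aE bE] := dsigma a b dM.
pose c i := count_mem (i, s0) (codom sigma).
have c_lt i : (c i < (a i).+1)%N by rewrite ltnS aE count_fst leq_addr.
pose t := (Ordinal (c_lt o0), Ordinal (c_lt o1), Ordinal (c_lt o2)).
have tX : t \in X by rewrite inE /= bE count_snd.
have t_c i : triple_fun t i = c i by move: i; apply: ord3P.
exists (enum_rank_in tX t); rewrite enum_rankK_in //.
(* M and S t have the same matrix of multiplicities: its second column is
   determined by the first one and by the row sums a. *)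
have MS : weakly_equivalent M (S t).
  apply: weakly_equivalent_trans Msigma _.
  apply/(weakly_equivalent_split omega_prim sign_prim)/perm_count_mem => -[i j].
  rewrite count_tau /mult /col_mult /= t_c; move: j; apply: ord2P => //=.
  by rewrite aE count_fst addKn.
rewrite defC; apply: functional_extensionality => Q.
apply: propositional_extensionality; split=> [MQ|SQ].
  exact: weakly_equivalent_trans (weakly_equivalent_sym MS) MQ.
exact: weakly_equivalent_trans MS SQ.
Qed.
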